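(* Let $M$ be a matroid of rank $r$ on ground set $[n]$ and let $H$ be a stressed hyperplane of $M$ with $|H|=s$. Then for every nonnegative integer $t$, \[ \mathrm{ehr}_{\mathrm{Rel}_H(M)}(t)=\mathrm{ehr}_{M}(t)+\frac{n-s}{(n-1)!}\binom{t-1+n-s}{n-s}\tilde{\phi}_{r,s,n}(t), \] where \[ \tilde{\phi}_{r,s,n}(t)=\sum_{i=0}^{s-r}(-1)^i\binom{s}{i}\sum_{\ell=0}^{s-1}(n-2-\ell)!\,\ell!\binom{s-2-\ell-i+t(s-r-i+1)}{s-1-\ell}\binom{s-1-i+t(s-r-i)}{\ell}. \]
   Context: A hyperplane of a rank-$r$ matroid is a flat of rank $r-1$; it is stressed if every subset of it of size $r-1$ is independent. If $\mathcal{B}$ is the basis system of $M$ and $H$ is a stressed hyperplane, $\mathrm{Rel}_H(M)$ is the matroid with basis system $\mathcal{B}\cup\binom{H}{r}$. The base polytope of $M$ on $[n]$ is $\mathcal{P}_M=\mathrm{conv}\{\sum_{i\in B}\mathbf{e}_i: B\text{ a basis}\}\subset\mathbb{R}^n$ and $\mathrm{ehr}_M(t)=|t\mathcal{P}_M\cap\mathbb{Z}^n|$. Binomial coefficients $\binom{x}{k}$ with arbitrary (possibly negative) integer top $x$ and integer $k\ge0$ mean $x(x-1)\cdots(x-k+1)/k!$. *)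

(* Defs.v *)
From mathcomp Require Import all_boot.

Set Implicit Arguments.
Unset Strict Implicit.
Unset Printing Implicit Defensive.

Record matroid (E : finType) := Matroid {
  bases : {set {set E}};
  bases_neq0 : bases != set0;
  bases_exchange : forall (B1 B2 : {set E}) (x : E),
    B1 \in bases -> B2 \in bases -> x \in B1 :\: B2 ->
    exists2 y : E, y \in B2 :\: B1 & y |: (B1 :\ x) \in bases
}.

Section MatroidNotions.
Variables (E : finType) (M : matroid E).
Implicit Types A H I : {set E}.

Definition indep I := [exists B in bases M, I \subset B].

Definition rank_of A : nat := \max_(I : {set E} | indep I && (I \subset A)) #|I|.

Definition rank : nat := rank_of [set: E].

Definition flat H := [forall x, (x \notin H) ==> (rank_of H < rank_of (x |: H))].

(* Ranks and cardinals that the literature writes as r - 1 are compared through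
   a successor, since subtraction on nat is truncated: a matroid of rank 0 has
   no hyperplane. *)
Definition hyperplane H := flat H && (rank == (rank_of H).+1).

Definition stressed_hyperplane H :=
  hyperplane H && [forall A : {set E}, (A \subset H) && (#|A|.+1 == rank) ==> indep A].

End MatroidNotions.

Section Relaxation.
Variables (E : finType) (M : matroid E).
Implicit Types A B H I : {set E}.

Lemma bases_card B1 B2 : B1 \in bases M -> B2 \in bases M -> #|B1| = #|B2|.
Proof.
move: {2}#|B1 :\: B2| (leqnn #|B1 :\: B2|) => k.
elim: k B1 => [|k IHk] B1 hk b1 b2.
  have sB : B1 \subset B2.
    by rewrite -setD_eq0 -cards_eq0 -leqn0.
  case: (boolP (B2 \subset B1)) => [sB'|/subsetPn [x xB2 xB1]].
    by congr #|pred_of_set _|; apply/eqP; rewrite eqEsubset sB.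
  have xD : x \in B2 :\: B1 by rewrite inE xB1.
  have [y + _] := bases_exchange b2 b1 xD.
  by rewrite inE => /andP[/negP + yB1]; case; apply: (subsetP sB).
case: (posnP #|B1 :\: B2|) => [h0|]; first by apply: (IHk) => //; rewrite h0.
case/card_gt0P => x xD.
have [y yD b1'] := bases_exchange b1 b2 xD.
move: (xD) (yD); rewrite !inE => /andP[xB2 xB1] /andP[yB1 yB2].
have <- : #|y |: B1 :\ x| = #|B1|.
  by rewrite cardsU1 !inE (negbTE yB1) andbF (cardsD1 x B1) xB1.
apply: IHk => //.
have : #|(y |: B1 :\ x) :\: B2| <= #|(B1 :\: B2) :\ x|.
  apply/subset_leq_card/subsetP => z; rewrite !inE.
  case/andP => zB2 /orP[/eqP zy|/andP[-> ->]]; last by rewrite zB2.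
  by rewrite zy yB2 in zB2.
by move/leq_trans; apply; rewrite -ltnS; move: hk; rewrite (cardsD1 x (B1 :\: B2)) xD.
Qed.

Lemma indep_leq_rank_of I A : indep M I -> I \subset A -> #|I| <= rank_of M A.
Proof.
by move=> iI sI; apply: (@leq_bigmax_cond _ _ (fun J : {set E} => #|J|)); rewrite iI.
Qed.

Lemma base_card B : B \in bases M -> #|B| = rank M.
Proof.
move=> bB; apply/eqP; rewrite eqn_leq; apply/andP; split.
  apply: indep_leq_rank_of; last exact: subsetT.
  by apply/existsP; exists B; rewrite bB /=.
apply/bigmax_leqP => I /andP[/existsP[B' /andP[bB' sI]] _].
by rewrite (bases_card bB bB') subset_leq_card.
Qed.

Lemma indep_base I : indep M I -> #|I| = rank M -> I \in bases M.
Proof.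
case/existsP => B /andP[bB sI] cI.
suff -> : I = B by [].
by apply/eqP; rewrite eqEcard sI cI (base_card bB) leqnn.
Qed.

Lemma indep_augment I B : indep M I -> #|I|.+1 = rank M -> B \in bases M ->
  exists2 w, w \in B :\: I & w |: I \in bases M.
Proof.
case/existsP => B1 /andP[b1 sI] cI bB.
have /card_gt0P [x] : 0 < #|B1 :\: I|.
  by rewrite cardsD (setIidPr sI) (base_card b1) -cI subSnn.
rewrite inE => /andP[xI xB1].
have eI : I = B1 :\ x.
  apply/eqP; rewrite eqEcard subsetD1 sI xI /=.
  by rewrite -ltnS cI -(base_card b1) (cardsD1 x B1) xB1.
have [xB|xB] := boolP (x \in B).
  by exists x; rewrite ?inE ?xI // eI setD1K.
have [|y yD b'] := bases_exchange b1 bB (x := x); first by rewrite inE xB xB1.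
exists y; last by rewrite eI.
by move: yD; rewrite !inE => /andP[yB1 ->]; rewrite andbT (contra (subsetP sI y)).
Qed.

Lemma stressed_extend H I z : stressed_hyperplane M H ->
  I \subset H -> #|I|.+1 = rank M -> z \notin H -> z |: I \in bases M.
Proof.
case/andP => /andP[/forallP fH /eqP rH] /forallP sH IH cI zH.
have iI : indep M I by apply: (implyP (sH I)); rewrite IH cI eqxx.
have : rank_of M H < rank_of M (z |: H) by apply: (implyP (fH z)).
rewrite -rH => hr.
have [J /andP[iJ JH] cJ] : exists2 J : {set E},
    indep M J && (J \subset z |: H) & rank M <= #|J|.
  apply/exists_inP; apply: contraLR hr; rewrite negb_exists_in => /forall_inP hJ.
  rewrite -ltnNge; have -> : rank M = (rank M).-1.+1 by rewrite rH.
  rewrite ltnS; apply/bigmax_leqP => J hJ'.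
  by rewrite -ltnS prednK ?rH // -rH ltnNge hJ.
have bJ : J \in bases M.
  apply: indep_base => //; apply/eqP; rewrite eqn_leq cJ andbT.
  by apply: indep_leq_rank_of => //; apply: subsetT.
have [w + bw] := indep_augment iI cI bJ.
rewrite inE => /andP[wI wJ].
have := subsetP JH w wJ; rewrite inE in_set1 => /orP[/eqP <- //|wH].
have : #|w |: I| <= rank_of M H.
  apply: indep_leq_rank_of; last by rewrite subUset sub1set wH.
  by apply/existsP; exists (w |: I); rewrite bw /=.
by rewrite (base_card bw) rH ltnn.
Qed.

Definition relaxed_bases H : {set {set E}} :=
  bases M :|: [set A : {set E} | (A \subset H) && (#|A| == rank M)].

Lemma relaxed_bases_neq0 H : relaxed_bases H != set0.
Proof. by rewrite setU_eq0 negb_and bases_neq0. Qed.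

Lemma relaxed_bases_exchange H : stressed_hyperplane M H ->
  forall (B1 B2 : {set E}) (x : E),
    B1 \in relaxed_bases H -> B2 \in relaxed_bases H -> x \in B1 :\: B2 ->
    exists2 y : E, y \in B2 :\: B1 & y |: (B1 :\ x) \in relaxed_bases H.
Proof.
move=> sH B1 B2 x b1 b2 xD.
have crd B : B \in relaxed_bases H -> #|B| = rank M.
  by rewrite !inE => /orP[/base_card //|/andP[_ /eqP]].
have cU y : y \in B2 :\: B1 -> #|y |: B1 :\ x| = rank M.
  move: xD; rewrite !inE => /andP[_ xB1] /andP[yB1 _].
  by rewrite cardsU1 !inE (negbTE yB1) andbF -(crd _ b1) (cardsD1 x B1) xB1.
have cB1 : #|B1 :\ x|.+1 = rank M.
  by move: xD; rewrite inE -(crd _ b1) (cardsD1 x B1) => /andP[_ ->].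
have ex : exists y, y \in B2 :\: B1.
  apply/card_gt0P; rewrite cardsD setIC (crd _ b2) -(crd _ b1) -cardsD.
  by apply/card_gt0P; exists x.
have [xB2 xB1] : x \notin B2 /\ x \in B1 by apply/andP; rewrite inE in xD.
have [h1|h1] := boolP (B1 :\ x \subset H).
  have [h2|/subsetPn [z zB2 zH]] := boolP (B2 \subset H).
    have [y yD] := ex; exists y => //; rewrite !inE cU // eqxx andbT.
    rewrite subUset sub1set h1 andbT (subsetP h2) ?orbT //.
    by move: yD; rewrite inE => /andP[].
  have [zB1|zB1] := boolP (z \in B1); last first.
    by exists z; rewrite inE ?zB1 // (stressed_extend sH).
  have zx : z = x.
    by apply/eqP/negPn/negP => zx; move: zH; rewrite (subsetP h1) // !inE zx.
  by rewrite -zx zB2 in xB2.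
have b1' : B1 \in bases M.
  move: b1; rewrite !inE => /orP[//|/andP[s1 _]].
  by case/negP: h1; apply: subset_trans s1; apply: subsetDl.
move: b2; rewrite !inE => /orP[b2|/andP[s2 c2]].
  by have [y yD bY] := bases_exchange b1' b2 xD; exists y; rewrite // inE bY.
have /subsetPn [z zB1 zH] := h1.
have [y0 y0D] := ex.
have y0B2 : y0 \in B2 by move: y0D; rewrite inE => /andP[].
have bI : z |: B2 :\ y0 \in bases M.
  apply: (stressed_extend sH) => //; first by apply: subset_trans s2; apply: subsetDl.
  by rewrite -(eqP c2) (cardsD1 y0 B2) y0B2.
have iB : indep M (B1 :\ x) by apply/existsP; exists B1; rewrite b1' subsetDl.
have [w wD bw] := indep_augment iB cB1 bI.
exists w; last by rewrite inE bw.
move: wD; rewrite inE => /andP[wB1].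
rewrite 2!inE => /orP[/eqP wz|]; first by rewrite wz zB1 in wB1.
rewrite !inE => /andP[_ wB2]; rewrite wB2 andbT.
apply: contra wB1 => wB1; rewrite !inE wB1 andbT.
by apply: contraNneq xB2 => <-.
Qed.

Definition relaxation H (sH : stressed_hyperplane M H) : matroid E :=
  Matroid (relaxed_bases_neq0 H) (relaxed_bases_exchange sH).

End Relaxation.

From mathcomp Require Import all_order all_algebra finmap.
From mathcomp Require Import boolp classical_sets functions cardinality reals.
From mathcomp Require Import interval_inference convex lra.

Import Order.TTheory GRing.Theory Num.Theory.

Local Open Scope classical_set_scope.
Local Open Scope ring_scope.
Local Open Scope convex_scope.

Section Ehrhart.
Variable R : realType.

Definition conv_hull n (A : set 'rV[R]_n) : set 'rV[R]_n :=
  smallest (@convex_set R 'rV[R]_n) A.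

Definition indicator_vec n (B : {set 'I_n}) : 'rV[R]_n := \row_i (i \in B)%:R.

Definition base_polytope n (M : matroid 'I_n) : set 'rV[R]_n :=
  conv_hull [set indicator_vec B | B in [set B | B \in bases M]].

Definition dilated_lattice_points n (P : set 'rV[R]_n) (t : nat) : set 'rV[R]_n :=
  [set t%:R *: x | x in P] `&` [set x | forall i, x 0 i \is a Num.int].

Lemma base_polytope_lattice_finite n (M : matroid 'I_n) t :
  finite_set (dilated_lattice_points (base_polytope M) t).
Proof.
pose f (g : {ffun 'I_n -> 'I_t.+1}) : 'rV[R]_n := \row_i (g i)%:R.
apply: (@sub_finite_set _ _ [set f g | g in [set: {ffun 'I_n -> 'I_t.+1}]]); last first.
  exact/finite_image/finite_finset.
move=> _ [[y yP <-] yint].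
have bnd i : 0 <= y 0 i <= 1.
  apply: (yP [set y : 'rV[R]_n | 0 <= y 0 i <= 1]); split.
    apply/convex_setW => a b; rewrite !inE /= => /andP[a0 a1] /andP[b0 b1] k k0 k1.
    have -> : a <| k |> b = k%:num *: (a : 'rV[R]_n) + (1 - k%:num) *: (b : 'rV[R]_n) by [].
    rewrite inE /= !mxE; move: (k%:num) k0 k1 => u u0 u1.
    by apply/andP; split; nra.
  by move=> _ [B _ <-] /=; rewrite mxE; case: (i \in B); rewrite /= ?lexx ler01.
have nat_coord i : {m : 'I_t.+1 | t%:R * y 0 i = m%:R}.
  have /andP[y0 y1] := bnd i; apply/cid.
  have /natrP [m ym] : t%:R * y 0 i \is a Num.nat.
    by rewrite natrEint mulr_ge0 ?ler0n // andbT; have := yint i; rewrite mxE.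
  have mt : (m < t.+1)%N by rewrite ltnS -(ler_nat R) -ym ler_piMr ?ler0n.
  by exists (Ordinal mt).
exists [ffun i => sval (nat_coord i)] => //; apply/rowP => i.
by rewrite !mxE ffunE -(svalP (nat_coord i)).
Qed.

(* [fset_set] returns the empty set on infinite sets; the previous lemma shows
   that this default is never used. *)
Definition ehr n (M : matroid 'I_n) (t : nat) : nat :=
  #|` fset_set (dilated_lattice_points (base_polytope M) t)|.

End Ehrhart.

(* x (x - 1) ... (x - k + 1) / k!, for a top x of any sign. *)
Definition binz (x : int) (k : nat) : rat :=
  (\prod_(j < k) (x - j%:Z)%:~R) / k`!%:R.

(* A stressed hyperplane of cardinal s in a matroid of rank r on n elements has
   r <= s + 1 and s + 1 <= n, so all the subtractions on nat below are exact;
   the outer sum runs over i = 0, ..., s - r and is empty when s = r - 1. The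
   tops of the binomial coefficients, which can be negative, are integers. *)
Definition phi_tilde (r s n t : nat) : rat :=
  \sum_(0 <= i < s.+1 - r)
     (-1) ^+ i * 'C(s, i)%:R *
     \sum_(0 <= l < s)
        (n - 2 - l)`!%:R * l`!%:R
        * binz (s%:Z - 2 - l%:Z - i%:Z + t%:Z * (s%:Z - r%:Z - i%:Z + 1)) (s - 1 - l)
        * binz (s%:Z - 1 - i%:Z + t%:Z * (s%:Z - r%:Z - i%:Z)) l.

(* Main.v *)
(* Relaxing [H] only drops the facet [x(H) <= r - 1] of the base polytope, so
   the new lattice points of the [t]-th dilate are the [g : [n] -> {0..t}] with
   sum [r t] and [g(H) > (r - 1) t], that is, [g(~: H) < t].
   - Such a [g] is a sum of [t] bases of the relaxation: peel off one base at a
     time, containing every coordinate equal to [t] and contained in the support.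
   - Conversely, a point of the cone over the relaxed bases with
     [r x(H) <= (r - 1) x(E)] lies in the cone over the bases of [M]: each
     [r]-subset [A] of [H] can be absorbed by bases [B] with [|B :&: H| < r - 1],
     an exchange turning [e_A + e_B] into a sum of two bases of [M].
   - The new points are counted by a coefficient of
     [(1 + X + ... + X^t)^s (1 + Y + ... + Y^t)^(n - s)], and the resulting sum
     over [j = g(~: H)] is evaluated by a telescoping identity for falling
     factorials. *)
Require Import Defs.
From mathcomp Require Import all_boot all_order all_algebra finmap.
From mathcomp Require Import boolp classical_sets functions cardinality reals.
From mathcomp Require Import interval_inference convex.
From mathcomp Require Import ring zify lra.

Set Implicit Arguments.
Unset Strict Implicit.
Unset Printing Implicit Defensive.

Import Order.TTheory GRing.Theory Num.Theory.

Local Open Scope ring_scope.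

(** * A binomial identity *)

Definition falling (x : rat) (k : nat) : rat := \prod_(j < k) (x - j%:R).

Lemma falling_recr x k : falling x k.+1 = falling x k * (x - k%:R).
Proof. exact: big_ord_recr. Qed.

Lemma falling_recl x k : falling x k.+1 = x * falling (x - 1) k.
Proof.
rewrite /falling big_ord_recl subr0; congr (_ * _); apply: eq_bigr => j _.
by rewrite lift0 -natr1; ring.
Qed.

Lemma binzE x k : binz x k = falling x%:~R k / k`!%:R.
Proof. by congr (_ / _); apply: eq_bigr => j _; rewrite rmorphB. Qed.

Lemma falling_nat a k : falling a%:R k = (a ^_ k)%:R.
Proof.
elim: k a => [|k IHk] a; first by rewrite /falling big_ord0.
rewrite falling_recl; case: a => [|a]; first by rewrite mul0r.
by rewrite -[a.+1%:R]natr1 addrK IHk ffactSS natrM natr1.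
Qed.

Lemma fact_neq0 k : k`!%:R != 0 :> rat.
Proof. by rewrite pnatr_eq0 -lt0n fact_gt0. Qed.

Lemma binz_nat a k : binz a%:Z k = 'C(a, k)%:R.
Proof. by rewrite binzE falling_nat -bin_ffact natrM mulfK ?fact_neq0. Qed.

(* The induction step is
   [(t + m + 1) (a + t) - t (a + t - 1 - p) + a (p + 1) = (a + t) (m + p + 2)]. *)
Lemma sum_falling_diff (m p : nat) (a t : rat) :
  \sum_(l < p.+1) (m + p - l)`!%:R / (p - l)`!%:R * falling a l
     * ((t + m.+1%:R) * falling (a + t - l%:R) (p - l)
        - t * falling (a + t - 1 - l%:R) (p - l))
  = (m + p).+1`!%:R / p`!%:R * falling (a + t) p.
Proof.
elim: p a => [|p IHp] a.
  rewrite big_ord1 /falling !big_ord0 subnn subn0 addn0 factS natrM.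
  by rewrite -[m.+1%:R]natr1; field; rewrite fact_neq0.
(* Every term with [l > 0] carries the factor [a] of [falling a l]; what remains is the same
   identity at [a - 1] and [p], so the induction keeps [a] general. *)
rewrite big_ord_recl.
under eq_bigr => l _.
  rewrite lift0 falling_recl addnS !subSS -[l.+1%:R]natr1.
  have -> : a + t - (l%:R + 1) = a - 1 + t - l%:R by ring.
  have -> : a + t - 1 - (l%:R + 1) = a - 1 + t - 1 - l%:R by ring.
  rewrite [_ / _ * (a * _)]mulrCA -mulrA.
  over.
rewrite -mulr_sumr IHp !subn0 !subr0 {1}/falling big_ord0 falling_recl falling_recr.
have -> : a - 1 + t = a + t - 1 by ring.
rewrite addnS [(m + p).+2`!]factS [p.+1`!]factS !natrM.
have p0 : p%:R + 1 != 0 :> rat by rewrite natr1 pnatr_eq0.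
have := fact_neq0 p; rewrite -[(m + p).+2%:R]natr1 -[(m + p).+1%:R]natr1 natrD.
rewrite -[m.+1%:R]natr1 -[p.+1%:R]natr1 => h.
by field; rewrite p0 h.
Qed.

(** Induction on [t]: by [e1] and [e2] the closed forms at [t + 1] and [t] are both multiples of
    ['C(t + m, m)], and their difference is evaluated by [sum_falling_diff]. *)
Lemma sum_bin_falling (m p t : nat) (a : rat) :
  \sum_(j < t) 'C(j + m, m)%:R * (falling (a + j%:R) p / p`!%:R)
  = m.+1%:R / (m + p).+1`!%:R * 'C(t + m, m.+1)%:R
    * \sum_(l < p.+1) (m + p - l)`!%:R / (p - l)`!%:R * falling a l
        * falling (a + t%:R - 1 - l%:R) (p - l).
Proof.
have hf := fact_neq0 (m + p).+1.
elim: t => [|t IHt]; first by rewrite big_ord0 add0n bin_small // mulr0 mul0r.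
have e1 : m.+1%:R * 'C(t.+1 + m, m.+1)%:R = (t%:R + m.+1%:R) * 'C(t + m, m)%:R :> rat.
  by rewrite addSn -natrD -!natrM -mul_bin_diag addnS.
have e2 : m.+1%:R * 'C(t + m, m.+1)%:R = t%:R * 'C(t + m, m)%:R :> rat.
  by rewrite -!natrM mul_bin_left addnK.
rewrite big_ord_recr IHt /= ![m.+1%:R / _ * _]mulrAC e1 e2.
have e3 := sum_falling_diff m p a t%:R.
have {e3} : falling (a + t%:R) p / p`!%:R = (m + p).+1`!%:R^-1 *
  (\sum_(l < p.+1) (m + p - l)`!%:R / (p - l)`!%:R * falling a l
     * ((t%:R + m.+1%:R) * falling (a + t%:R - l%:R) (p - l)
        - t%:R * falling (a + t%:R - 1 - l%:R) (p - l))).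
  by rewrite e3; have := fact_neq0 p => h; field; rewrite h hf.
move=> ->.
have -> : \sum_(l < p.+1) (m + p - l)`!%:R / (p - l)`!%:R * falling a l
     * ((t%:R + m.+1%:R) * falling (a + t%:R - l%:R) (p - l)
        - t%:R * falling (a + t%:R - 1 - l%:R) (p - l))
   = (t%:R + m.+1%:R) * (\sum_(l < p.+1) (m + p - l)`!%:R / (p - l)`!%:R * falling a l
        * falling (a + t.+1%:R - 1 - l%:R) (p - l))
   - t%:R * (\sum_(l < p.+1) (m + p - l)`!%:R / (p - l)`!%:R * falling a l
        * falling (a + t%:R - 1 - l%:R) (p - l)).
  rewrite !mulr_sumr -sumrB; apply: eq_bigr => l _.
  have -> : a + t.+1%:R - 1 - l%:R = a + t%:R - l%:R by rewrite -natr1; ring.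
  by rewrite mulrBr; congr (_ - _); rewrite mulrCA.
by field.
Qed.

(** For [m = n - s - 1], [p = s - 1] and [a = s - 1 - i + t (s - r - i)], the sum over [l] is the
    inner sum of [phi_tilde]. *)
Lemma sum_bin_binz (m p t : nat) (a : int) :
  \sum_(j < t) 'C(j + m, m)%:R * binz (a + j%:Z) p
  = m.+1%:R / (m + p).+1`!%:R * 'C(t + m, m.+1)%:R
    * \sum_(l < p.+1) (m + p - l)`!%:R * l`!%:R * binz (a + t%:Z - 1 - l%:Z) (p - l)
        * binz a l.
Proof.
under eq_bigr => j _ do rewrite binzE rmorphD /=.
rewrite sum_bin_falling; congr (_ * _); apply: eq_bigr => l _.
rewrite !binzE !rmorphB rmorphD /=.
by field; rewrite !fact_neq0.
Qed.

(** * Counting bounded lattice points *)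

Section CoefGeometricPower.
Variable R : comNzRingType.
Implicit Types (p q t k N : nat).

(** The polynomial truncates the series of [(1 - X)^-(p+1)]. One factor [1 - X] lowers [p] by
    Pascal's rule, up to a multiple of [X^N]. *)
Lemma mul_subX_series p N : exists W : {poly R},
  (1 - 'X) ^+ p.+1 * \poly_(k < N) 'C(k + p, p)%:R = 1 + 'X^N * W.
Proof.
elim: p => [|p [W IHp]].
  exists (-1); rewrite expr1 poly_def mulrN1 -[RHS]opprB subrX1 -mulNr opprB.
  by congr (_ * _); apply: eq_bigr => i _; rewrite bin0 scale1r.
have e : (1 - 'X) * \poly_(k < N) 'C(k + p.+1, p.+1)%:R
  = \poly_(k < N) 'C(k + p, p)%:R - 'X^N * 'C(N + p, p.+1)%:R%:P :> {poly R}.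
  apply/polyP => k; rewrite mulrBl mul1r !coefB coefXM !coef_poly coefXnM coefC.
  case: k => [|k] /=.
    case: N {IHp} => [|N] /=; first by rewrite add0n bin_small // eqxx !subr0.
    by rewrite !add0n !binn.
  case: (ltngtP k.+1 N) => kN.
  - by rewrite addSn binS addnS -addSn natrD subr0 addrAC subrr add0r.
  - by rewrite subn_eq0 leqNgt kN /= subrr.
  by rewrite -kN subnn eqxx addSn addnS.
rewrite exprSr -mulrA e mulrBr IHp.
exists (W - (1 - 'X) ^+ p.+1 * 'C(N + p, p.+1)%:R%:P).
by ring.
Qed.

(* Modulo [X^N] with [k < N], the truncated series of [(1 - X)^-q] inverts the
   denominator of [((1 - X^(t+1)) / (1 - X))^q]. *)
Lemma coef_geometric_pow p t k :
  ((\sum_(x < t.+1) 'X^x : {poly R}) ^+ p.+1)`_k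
  = \sum_(i < p.+2) (-1) ^+ i * 'C(p.+1, i)%:R
      * (if (k < i * t.+1)%N then 0 else 'C(k - i * t.+1 + p, p)%:R).
Proof.
have [W eW] := mul_subX_series p k.+1.
set G := \sum_(x < t.+1) 'X^x; set Q := \poly_(_ < _) _ in eW.
have eG : (1 - 'X) * G = 1 - 'X^(t.+1) by rewrite -[RHS]opprB subrX1 -mulNr opprB.
(* The truncation error is a multiple of [X^(k+1)], hence invisible to the coefficient of [X^k]. *)
have {eW} eq : G ^+ p.+1 = (1 - 'X^(t.+1)) ^+ p.+1 * Q - 'X^(k.+1) * (W * G ^+ p.+1).
  have -> : (1 - 'X^(t.+1)) ^+ p.+1 * Q = ((1 - 'X) ^+ p.+1 * Q) * G ^+ p.+1.
    by rewrite -eG exprMn; ring.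
  by rewrite eW; ring.
rewrite eq coefB coefXnM ltnSn subr0 exprBn mulr_suml coef_sum.
apply: eq_bigr => i _.
rewrite expr1n mulr1 -exprM mulnC -mulr_natr.
have -> : (-1) ^+ i * 'X^(i * t.+1) * 'C(p.+1, i)%:R * Q
   = ((-1) ^+ i * 'C(p.+1, i)%:R)%:P * ('X^(i * t.+1) * Q).
  by rewrite rmorphM /= rmorphXn /= rmorphN1 rmorph_nat; ring.
rewrite coefCM coefXnM coef_poly; case: ifP => // _.
by rewrite ltnS leq_subr.
Qed.

End CoefGeometricPower.

Lemma coef_geometric_pow_small (R : comNzRingType) (p t k : nat) : (k <= t)%N ->
  ((\sum_(x < t.+1) 'X^x : {poly R}) ^+ p.+1)`_k = 'C(k + p, p)%:R.
Proof.
move=> kt; rewrite coef_geometric_pow big_ord_recl big1 => [|i _].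
  by rewrite mul0n subn0 expr0 bin0 !mul1r addr0.
by rewrite lift0 mulSn (leq_ltn_trans kt) ?mulr0 // addSn ltnS leq_addr.
Qed.

Lemma sum_nat_setC (I : finType) (A : {set I}) (F : I -> nat) :
  (\sum_i F i = \sum_(i in A) F i + \sum_(i in ~: A) F i)%N.
Proof.
by rewrite (bigID (mem A)) /=; congr addn; apply: eq_bigl => i; rewrite inE.
Qed.

(** * Cap points counted by generating functions *)

Section LatticeCount.
Variables (n t : nat) (H : {set 'I_n}).
Implicit Types g : {ffun 'I_n -> 'I_t.+1}.

(** In a bivariate generating function the outer variable records [g] off [H] and the inner one
    [t - g] on [H]. As [j <= t], the bound on the coordinates off [H] does not affect the outer
    coefficient ['C(j + m, m)]. *)
Lemma card_split_sums m j k : #|~: H| = m.+1 -> (j <= t)%N ->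
  #|[pred g : {ffun 'I_n -> 'I_t.+1} |
      (\sum_(i in ~: H) g i == j)%N && (\sum_(i in H) (t - g i) == k)%N]|%:R
  = 'C(j + m, m)%:R * ((\sum_(x < t.+1) 'X^x) ^+ #|H|)`_k :> rat.
Proof.
move=> cH jt.
pose G (R : comNzRingType) : {poly R} := \sum_(x < t.+1) 'X^x.
pose F (i : 'I_n) (x : 'I_t.+1) : {poly {poly rat}} :=
  if i \in H then ('X^(t - x))%:P else 'X^x.
have prodF : \prod_i \sum_x F i x = (G rat ^+ #|H|)%:P * G {poly rat} ^+ m.+1.
  rewrite (bigID (mem H)) /= -cH rmorphXn /=; congr (_ * _).
    rewrite (eq_bigr (fun=> (G rat)%:P)) ?prodr_const // => i iH.
    rewrite /F iH -rmorph_sum /=; congr (_%:P).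
    by rewrite [RHS](reindex_inj rev_ord_inj); apply: eq_bigr => x _ /=; rewrite subSS.
  rewrite (eq_bigl [in ~: H]) => [|i]; last by rewrite inE.
  rewrite (eq_bigr (fun=> G {poly rat})) => [|i]; first by rewrite prodr_const.
  by rewrite inE /F => /negbTE ->.
have -> : 'C(j + m, m)%:R * (G rat ^+ #|H|)`_k = (\prod_i \sum_x F i x)`_j`_k.
  rewrite prodF (coefCM (G rat ^+ #|H|)) coef_geometric_pow_small //.
  by rewrite mulr_natr coefMn mulr_natl.
rewrite bigA_distr_bigA !coef_sum -sum1_card natr_sum big_mkcond /=.
apply: eq_bigr => g _.
rewrite (bigID (mem H)) /=.
have -> : \prod_(i in H) F i (g i) = ('X^(\sum_(i in H) (t - g i)))%:P.
  rewrite -prodrXr rmorph_prod; apply: eq_bigr => i iH.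
  by rewrite /F iH.
have -> : \prod_(i | i \notin H) F i (g i) = 'X^(\sum_(i in ~: H) g i).
  rewrite -prodrXr (eq_bigl [in ~: H]) => [|i]; last by rewrite inE.
  by apply: eq_bigr => i; rewrite inE /F => /negbTE ->.
rewrite (coefCM 'X^_) coefXn mulr_natr coefMn coefXn -mulrnA !inE mulnb.
by rewrite andbC [k == _]eq_sym [j == _]eq_sym; case: andb.
Qed.

Definition cap_points r :=
  [pred g : {ffun 'I_n -> 'I_t.+1} |
    (\sum_i g i == r * t)%N && (\sum_(i in ~: H) g i < t)%N].

(** If [g] sums to [r t] in all and to [j] off [H], then [t - g] sums to [(#|H| - r) t + j] on
    [H]. *)
Lemma card_cap_points_split m r : #|~: H| = m.+1 -> (0 < r <= #|H|)%N ->
  #|cap_points r|%:R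
  = \sum_(j < t) 'C(j + m, m)%:R
      * ((\sum_(x < t.+1) 'X^x) ^+ #|H|)`_((#|H| - r) * t + j) :> rat.
Proof.
move=> cH /andP[r0 rs].
under eq_bigr => j _ do rewrite -(card_split_sums _ cH (ltnW (ltn_ord j))).
rewrite -natr_sum; congr (_%:R).
under eq_bigr => j _ do rewrite -(sum1_card (pred_of_simpl _)) big_mkcond.
rewrite exchange_big -(sum1_card (pred_of_simpl _)) big_mkcond; apply: eq_bigr => g _ /=.
have e1 := sum_nat_setC H (fun i => g i : nat).
have e2 : (\sum_(i in H) g i + \sum_(i in H) (t - g i) = #|H| * t)%N.
  rewrite -big_split -sum_nat_const; apply: eq_bigr => i _ /=.
  by rewrite subnKC // -ltnS.
under eq_bigr => j _ do rewrite inE.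
rewrite inE e1; move: e2.
set b := (\sum_(i in ~: H) g i)%N; set h := (\sum_(i in H) g i)%N.
set h' := (\sum_(i in H) (t - g i))%N => e2.
have [bt|tb] := ltnP b t; last first.
  rewrite andbF big1 // => j _; case: eqP => // bj.
  by have := ltn_ord j; rewrite -bj ltnNge tb.
rewrite (bigD1 (Ordinal bt)) //= eqxx big1 ?addn0 => [|j jb]; last first.
  by case: eqP => // bj; case/eqP: jb; apply: val_inj.
rewrite andbT; congr (if _ then _ else _).
have : (#|H| * t = (#|H| - r) * t + r * t)%N by rewrite -mulnDl subnK.
by move: e2; move: (_ * t)%N (_ * t)%N (_ * t)%N; lia.
Qed.

(* On [H] the coordinates are counted through [t - g i], which kills the terms
   [i > #|H| - r] of the alternating sum. *)
Lemma card_cap_points m r : #|~: H| = m.+1 -> (0 < r <= #|H|)%N ->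
  #|cap_points r|%:R
  = \sum_(i < #|H|.+1 - r) (-1) ^+ i * 'C(#|H|, i)%:R
    * \sum_(j < t) 'C(j + m, m)%:R
        * binz (#|H|%:Z - 1 - i%:Z + t%:Z * (#|H|%:Z - r%:Z - i%:Z) + j%:Z) (#|H| - 1)
    :> rat.
Proof.
move=> cH rs; rewrite (card_cap_points_split cH rs).
case/andP: rs => r0 rs.
under [RHS]eq_bigr => i _ do rewrite mulr_sumr.
rewrite exchange_big; apply: eq_bigr => j _ /=.
have [p eH] : exists p, #|H| = p.+1 by exists #|H|.-1; lia.
rewrite eH coef_geometric_pow mulr_sumr subn1 /=.
rewrite -(big_mkord xpredT (fun i => 'C(j + m, m)%:R * ((-1) ^+ i * 'C(p.+1, i)%:R *
  (if ((p.+1 - r) * t + j < i * t.+1)%N then 0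
   else 'C((p.+1 - r) * t + j - i * t.+1 + p, p)%:R)))).
have jt := ltn_ord j.
rewrite (@big_cat_nat _ _ _ (p.+2 - r)) /= ?leq_subr //.
rewrite [X in _ + X]big_nat_cond [X in _ + X]big1 ?addr0 => [|i]; last first.
  rewrite andbT => /andP[i1 _].
  (* Here [i > #|H| - r], and [j < t] makes the inequality strict. *)
  have -> : ((p.+1 - r) * t + j < i * t.+1)%N by nia.
  by rewrite !mulr0.
rewrite big_mkord; apply: eq_bigr => i _.
rewrite mulrCA; congr (_ * (_ * _)).
have ir : (i + r <= p.+1)%N by have := ltn_ord i; lia.
(* Where truncation gives 0, the top of [binz] is an integer between 0 and [p - 1], so [binz]
   vanishes too; it is nonnegative because [i + r <= p + 1] and [0 < r]. *)
have [ki|ik] := ltnP.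
  have [a ea ap] : exists2 a : nat,
      p.+1%:Z - 1 - i%:Z + t%:Z * (p.+1%:Z - r%:Z - i%:Z) + j%:Z = a%:Z & (a < p)%N.
    exists ((p.+1 - r) * t + j + p - i * t.+1)%N; nia.
  by rewrite ea binz_nat bin_small.
rewrite -binz_nat; congr binz; nia.
Qed.

End LatticeCount.

(** * Cones over families of sets *)

Lemma sum_indicator (R : realType) n (A B : {set 'I_n}) :
  \sum_(i in A) indicator_vec R B 0 i = #|A :&: B|%:R.
Proof.
under eq_bigr => i _ do rewrite mxE.
rewrite -sum1_card natr_sum [RHS]big_mkcond [LHS]big_mkcond.
by apply: eq_bigr => i _; rewrite inE; case: (i \in A); case: (i \in B).
Qed.

Lemma sum_comb_indicator (R : realType) n (F : {set {set 'I_n}}) (w : {set 'I_n} -> R)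
    (A : {set 'I_n}) :
  \sum_(i in A) (\sum_(B in F) w B *: indicator_vec R B) 0 i
  = \sum_(B in F) w B * #|A :&: B|%:R.
Proof.
under eq_bigr => i _ do rewrite summxE.
rewrite exchange_big; apply: eq_bigr => B _ /=.
by rewrite -sum_indicator mulr_sumr; apply: eq_bigr => i _; rewrite mxE.
Qed.

Lemma sum_comb_indicatorT (R : realType) n (F : {set {set 'I_n}}) (w : {set 'I_n} -> R) :
  \sum_i (\sum_(B in F) w B *: indicator_vec R B) 0 i = \sum_(B in F) w B * #|B|%:R.
Proof.
rewrite (eq_bigl [in [set: 'I_n]%SET]) => [|i]; last by rewrite finset.in_setT.
by rewrite sum_comb_indicator; apply: eq_bigr => B _; rewrite finset.setTI.
Qed.

Section BaseCone.
Variables (R : realType) (n : nat).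
Implicit Types (F : {set {set 'I_n}}) (x y : 'rV[R]_n).

Definition base_cone F x := exists2 w : {set 'I_n} -> R,
  forall B, 0 <= w B & x = \sum_(B in F) w B *: indicator_vec R B.

Lemma base_cone0 F : base_cone F 0.
Proof. by exists (fun=> 0) => //; rewrite big1 // => B _; rewrite scale0r. Qed.

Lemma base_coneD F x y : base_cone F x -> base_cone F y -> base_cone F (x + y).
Proof.
move=> [w w0 ->] [v v0 ->]; exists (fun B => w B + v B) => [B|].
  by rewrite addr_ge0.
by rewrite -big_split; apply: eq_bigr => B _; rewrite scalerDl.
Qed.

Lemma base_coneZ F c x : 0 <= c -> base_cone F x -> base_cone F (c *: x).
Proof.
move=> c0 [w w0 ->]; exists (fun B => c * w B) => [B|]; first by rewrite mulr_ge0.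
by rewrite scaler_sumr; apply: eq_bigr => B _; rewrite scalerA.
Qed.

Lemma base_cone_gen F B : B \in F -> base_cone F (indicator_vec R B).
Proof.
move=> BF; exists (fun A => (A == B)%:R) => [A|]; first exact: ler0n.
rewrite (bigD1 B) //= eqxx scale1r big1 ?addr0 // => A /andP[_ /negbTE ->].
by rewrite scale0r.
Qed.

Lemma base_cone_sum F (I : finType) (P : pred I) (x : I -> 'rV[R]_n) :
  (forall i, P i -> base_cone F (x i)) -> base_cone F (\sum_(i | P i) x i).
Proof. by move=> h; apply: big_ind => //; [exact: base_cone0|exact: base_coneD]. Qed.

Lemma base_coneS F F' x : F \subset F' -> base_cone F x -> base_cone F' x.
Proof.
move=> FF' [w w0 ->]; apply: base_cone_sum => B BF.
by apply: base_coneZ => //; apply: base_cone_gen; apply: (fintype.subsetP FF').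
Qed.

End BaseCone.

(** * Base cones of a matroid and of its relaxation *)

Section StressedHyperplaneCone.
Variables (R : realType) (n : nat) (M : matroid 'I_n) (H : {set 'I_n}).
Hypothesis sH : stressed_hyperplane M H.
Let e := @indicator_vec R n.

Lemma rank_hyperplane : rank M = (rank_of M H).+1.
Proof. by case/andP: sH => /andP[_ /eqP]. Qed.

Lemma card_base_hyperplane B : B \in bases M -> (#|B :&: H| < rank M)%N.
Proof.
move=> bB; rewrite rank_hyperplane ltnS; apply: indep_leq_rank_of.
  by apply/existsP; exists B; rewrite bB finset.subsetIl.
exact: finset.subsetIr.
Qed.

(** Homogeneous form of the facet inequality [x(H) <= r - 1], which makes it enough to check each
    base. *)
Lemma base_cone_hyperplane_le (x : 'rV[R]_n) : base_cone (bases M) x ->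
  (rank M)%:R * \sum_(i in H) x 0 i <= (rank M).-1%:R * \sum_i x 0 i.
Proof.
case=> w w0 ->.
rewrite sum_comb_indicator sum_comb_indicatorT !mulr_sumr; apply: ler_sum => B bB.
rewrite (base_card bB) mulrCA [leRHS]mulrCA ler_wpM2l // -!natrM ler_nat.
rewrite [leqRHS]mulnC leq_mul2l finset.setIC -ltnS.
by rewrite prednK ?card_base_hyperplane ?orbT // rank_hyperplane.
Qed.

(* Each missing unit of [#|B :&: H|] lets one copy of [A] be traded with [B]
   for two bases of [M]. *)
Lemma base_cone_exchange d (A B : {set 'I_n}) :
  A \subset H -> #|A| = rank M -> B \in bases M ->
  (#|B :&: H| + d).+1 = rank M -> base_cone (bases M) (e B + d%:R *: e A).
Proof.
move=> AH cA; elim: d B => [|d IHd] B bB cB.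
  by rewrite scale0r addr0; apply: base_cone_gen.
have /card_gt0P [y] : (0 < #|B :\: H|)%N.
  by have := cardsID H B; rewrite (base_card bB); lia.
rewrite inE => /andP[yH yB].
have yA : y \notin A by apply: contra yH; apply: (fintype.subsetP AH).
have rB : B \in relaxed_bases M H by rewrite inE bB.
have rA : A \in relaxed_bases M H by rewrite !inE AH cA eqxx orbT.
have yD : y \in B :\: A by rewrite inE yA.
(* The exchange takes place in the relaxation. [B'] meets [H] in one more element than [B], still
   fewer than [r], so it is a base of [M]; [A] with [z] replaced by [y] is one because [H] is
   stressed. *)
have [z zD rB'] := relaxed_bases_exchange sH rB rA yD.
set B' := z |: B :\ y in rB'.
have [zB zA] : z \notin B /\ z \in A by apply/andP; rewrite inE in zD.
have zH := fintype.subsetP AH z zA.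
have cB' : #|B' :&: H| = #|B :&: H|.+1.
  have -> : B' :&: H = z |: (B :&: H).
    apply/finset.setP => i; rewrite !inE.
    have [->|iz] /= := eqVneq i z; first by rewrite zH.
    by have [->|] //= := eqVneq i y; rewrite (negbTE yH) andbF.
  by rewrite cardsU1 inE (negbTE zB).
have bB' : B' \in bases M.
  move: rB'; rewrite inE => /orP[//|]; rewrite inE => /andP[B'H /eqP cB''].
  move: cB cB'; rewrite (finset.setIidPl B'H) cB''.
  by move: #|_ :&: _| (rank M); clear; lia.
have bA' : y |: A :\ z \in bases M.
  apply: (stressed_extend sH) => //.
    by apply: fintype.subset_trans AH; apply: finset.subsetDl.
  by rewrite -cA (cardsD1 z A) zA.
have -> : e B + d.+1%:R *: e A = (e B' + d%:R *: e A) + e (y |: A :\ z).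
  have -> : e B' + d%:R *: e A + e (y |: A :\ z) = (e B' + e (y |: A :\ z)) + d%:R *: e A.
    by rewrite addrAC.
  have -> : e B' + e (y |: A :\ z) = e B + e A.
    apply/rowP => i; rewrite !mxE !inE.
    have [->|iz] := eqVneq i z.
      rewrite (negbTE zB) zA; case: eqVneq => [E|] /=; last by rewrite addr0 add0r.
      by move: yH; rewrite -E zH.
    by have [->|iy] := eqVneq i y; rewrite ?yB ?(negbTE yA) /= ?addr0 ?add0r.
  by rewrite -natr1 scalerDl scale1r addrA addrAC.
apply: base_coneD; last exact: base_cone_gen.
by apply: IHd => //; rewrite cB' addSnnS.
Qed.

(** The new sets carry total weight [mu], and the bases of [M] can absorb [D], as [B] absorbs [d B]
    copies of a new set. The inequality says exactly that [mu <= D]. *)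
Lemma relaxed_cone_hyperplane (x : 'rV[R]_n) : base_cone (relaxed_bases M H) x ->
  (rank M)%:R * \sum_(i in H) x 0 i <= (rank M).-1%:R * \sum_i x 0 i ->
  base_cone (bases M) x.
Proof.
case=> w w0 ->; set T := relaxed_bases M H :\: bases M.
have TP A : A \in T -> A \subset H /\ #|A| = rank M.
  by rewrite !inE => /andP[/negbTE -> /andP[? /eqP ?]].
have r0 : 0 < (rank M)%:R :> R by rewrite ltr0n rank_hyperplane.
pose mu := \sum_(A in T) w A.
pose d (B : {set 'I_n}) := ((rank M).-1 - #|B :&: H|)%N.
pose D := \sum_(B in bases M) w B * (d B)%:R.
have splitE (V : zmodType) (f : {set 'I_n} -> V) : \sum_(B in relaxed_bases M H) f B
    = \sum_(B in bases M) f B + \sum_(A in T) f A.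
  rewrite (big_setID (bases M)) /=.
  by rewrite (finset.setIidPr (finset.subsetUl _ _)).
rewrite sum_comb_indicator sum_comb_indicatorT => hle.
have muD : mu <= D.
  pose K := \sum_(B in bases M) w B * #|H :&: B|%:R.
  pose L := \sum_(B in bases M) w B.
  have eK : \sum_(B in relaxed_bases M H) w B * #|H :&: B|%:R = K + mu * (rank M)%:R.
    rewrite splitE mulr_suml; congr (_ + _); apply: eq_bigr => A /TP[AH <-].
    by rewrite (finset.setIidPr AH).
  have eL : \sum_(B in relaxed_bases M H) w B * #|B|%:R = (rank M)%:R * (L + mu).
    rewrite splitE mulrC mulrDl !mulr_suml; congr (_ + _); apply: eq_bigr => B.
      by move/base_card ->.
    by case/TP => _ ->.
  have eD : D = (rank M).-1%:R * L - K.
    rewrite mulr_sumr -sumrB; apply: eq_bigr => B /card_base_hyperplane kB.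
    rewrite finset.setIC /d natrB; first by ring.
    by move: kB; rewrite rank_hyperplane.
  move: hle; rewrite eK eL eD mulrCA ler_pM2l // rank_hyperplane -natr1 /=.
  by lra.
have mu0 : 0 <= mu by apply: sumr_ge0.
(* If [D = 0] then [mu = 0] and no new set has positive weight; otherwise division by [D] is
   possible. *)
rewrite splitE; have [D0|Dn0] := eqVneq D 0.
  have wT A : A \in T -> w A = 0.
    apply/psumr_eq0P => [B _|]; first exact: w0.
    by apply/eqP; rewrite eq_le mu0 -{2}D0 muD.
  rewrite [X in _ + X]big1 ?addr0 => [|A AT]; last by rewrite wT // scale0r.
  by exists w.
have D0 : 0 < D by rewrite lt_neqAle eq_sym Dn0 (le_trans mu0).
(* Pairing [B] with [A] at weight [w B * w A / D] uses up all the weight of the new sets and the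
   fraction [mu / D] of the weight of the bases. *)
have -> : \sum_(B in bases M) w B *: e B + \sum_(A in T) w A *: e A
  = (1 - mu / D) *: (\sum_(B in bases M) w B *: e B)
    + \sum_(B in bases M) \sum_(A in T) (w B * w A / D) *: (e B + (d B)%:R *: e A).
  set Z := \sum_(A in T) _.
  have inner B : \sum_(A in T) (w B * w A / D) *: (e B + (d B)%:R *: e A)
      = (mu / D) *: (w B *: e B) + (w B * (d B)%:R / D) *: Z.
    transitivity (\sum_(A in T)
        (w A *: ((w B / D) *: e B) + (w B * (d B)%:R / D) *: (w A *: e A))).
      apply: eq_bigr => A _; rewrite scalerDr !scalerA.
      by congr (_ *: _ + _ *: _); ring.
    rewrite big_split -scaler_suml -scaler_sumr !scalerA.
    by congr (_ *: _ + _); rewrite -/mu; ring.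
  rewrite [X in _ = _ + X](eq_bigr _ (fun B _ => inner B)).
  rewrite big_split -scaler_sumr -scaler_suml -mulr_suml -/D divff // scale1r.
  by rewrite scalerBl scale1r addrA addrNK.
apply: base_coneD.
  by apply: base_coneZ; [rewrite subr_ge0 ler_pdivrMr ?mul1r|exists w].
apply: base_cone_sum => B bB; apply: base_cone_sum => A /TP[AH cA].
apply: base_coneZ; first by rewrite !mulr_ge0 // invr_ge0 ltW.
apply: base_cone_exchange => //.
by have := card_base_hyperplane bB; rewrite /d; lia.
Qed.

End StressedHyperplaneCone.

(** * Lattice points of the cap *)

Lemma subset_between (T : finType) (X Y : {set T}) k :
  X \subset Y -> (#|X| <= k <= #|Y|)%N ->
  exists2 A : {set T}, (X \subset A) && (A \subset Y) & #|A| = k.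
Proof.
move=> XY /andP[Xk kY]; elim: k Xk kY => [|k IHk] Xk kY.
  by exists X; [rewrite subxx XY|apply/eqP; rewrite -leqn0].
move: Xk; rewrite leq_eqVlt => /orP[/eqP cX|Xk].
  by exists X; rewrite ?subxx.
have [A /andP[XA AY] cA] := IHk Xk (ltnW kY).
have /card_gt0P [y] : (0 < #|Y :\: A|)%N.
  by rewrite cardsD (finset.setIidPr AY) cA subn_gt0.
rewrite inE => /andP[yA yY]; exists (y |: A); last by rewrite cardsU1 yA cA.
rewrite (fintype.subset_trans XA) ?finset.subsetUr //=.
by rewrite finset.subUset finset.sub1set yY.
Qed.

Lemma sum_bounded_card (I : finType) (A : {set I}) (g : I -> nat) t :
  (forall i, g i <= t)%N ->
  (#|[set i in A | g i == t]%SET| * t <= \sum_(i in A) g i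
    <= #|[set i in A | (0 < g i)%N]%SET| * t)%N.
Proof.
move=> gt; rewrite -!sum_nat_const; apply/andP; split.
  rewrite [leqRHS](big_setID [set i | g i == t]%SET) /=.
  apply: leq_trans (leq_addr _ _).
  rewrite leq_eqVlt; apply/orP; left; apply/eqP.
  apply: eq_big => [i|i]; first by rewrite !inE.
  by rewrite inE => /andP[_ /eqP].
rewrite [leqLHS](big_setID [set i | (0 < g i)%N]%SET) /= [X in (_ + X)%N]big1 => [|i].
  rewrite addn0 (eq_bigl [in [set i in A | (0 < g i)%N]%SET]) => [|i]; last first.
    by rewrite !inE.
  exact: leq_sum.
by rewrite !inE lt0n negbK => /andP[/eqP].
Qed.

Section Peeling.
Variables (R : realType) (n : nat) (M : matroid 'I_n) (H : {set 'I_n}).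
Hypothesis sH : stressed_hyperplane M H.

(** The three conditions on [A] keep [g] minus the indicator of [A] nonnegative, bounded by [t] and
    of sum at most [t] off [H], so that peeling can go on. *)
Lemma relaxed_base_peel (g : 'I_n -> nat) t :
  (forall i, g i <= t.+1)%N -> (\sum_i g i = rank M * t.+1)%N ->
  (\sum_(i in ~: H) g i <= t.+1)%N ->
  exists2 A, A \in relaxed_bases M H &
    [/\ forall i, i \in A -> (0 < g i)%N, forall i, g i = t.+1 -> i \in A &
        (\sum_(i in ~: H) (g i - (i \in A)) <= t)%N].
Proof.
move=> gt gs gH; set b := (\sum_(i in ~: H) g i)%N in gH *.
have e1 : (\sum_(i in H) g i + b = rank M * t.+1)%N.
  by rewrite -gs (sum_nat_setC H).
have [r rE] : exists r, rank M = r.+1 by exists (rank_of M H); exact: rank_hyperplane.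
have /andP[] := sum_bounded_card H gt.
set X := [set i in H | _]%SET; set Y := [set i in H | (0 < _)%N]%SET => hX hY.
have XY : X \subset Y.
  by apply/fintype.subsetP => i; rewrite !inE => /andP[-> /eqP ->].
have gb i : i \notin H -> (g i <= b)%N.
  by move=> iH; rewrite /b (bigD1 i) ?inE //= leq_addr.
have YH (A : {set 'I_n}) : A \subset Y -> A \subset H.
  by move=> AY; apply/fintype.subsetP => i /(fintype.subsetP AY); rewrite inE => /andP[].
have Y0 (A : {set 'I_n}) i : A \subset Y -> i \in A -> (0 < g i)%N.
  by move=> AY /(fintype.subsetP AY); rewrite inE => /andP[].
(* If [b < t + 1], no coordinate off [H] is saturated and an [r]-subset of [H] will do. If
   [b = t + 1], the sum off [H] must drop, so one element is taken off [H] and the others in [H]. *)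
move: gH; rewrite leq_eqVlt => /orP[/eqP bt|bt]; last first.
  have XrY : (#|X| <= rank M <= #|Y|)%N.
    have hr : (r * t.+1 < \sum_(i in H) g i <= r.+1 * t.+1)%N.
      by move: e1; rewrite rE mulSn; lia.
    case/andP: hr => hr1 hr2; rewrite rE -(leq_pmul2r (ltn0Sn t)) (leq_trans hX) //=.
    by rewrite -(ltn_pmul2r (ltn0Sn t)) (leq_trans hr1).
  have [A /andP[XA AY] cA] := subset_between XY XrY.
  exists A; first by rewrite !inE YH // cA eqxx orbT.
  split=> [i||]; first exact: Y0.
    move=> i gi; apply: (fintype.subsetP XA); rewrite inE gi eqxx andbT.
    by apply: contraLR bt => /gb; rewrite gi -leqNgt.
  by apply: (@leq_trans b); [apply: leq_sum => i _; apply: leq_subr|].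
have XrY : (#|X| <= r <= #|Y|)%N.
  have eH : (\sum_(i in H) g i = r * t.+1)%N by move: e1; rewrite rE bt mulSn; lia.
  by apply/andP; split; rewrite -(leq_pmul2r (ltn0Sn t)) -eH.
have [A /andP[XA AY] cA] := subset_between XY XrY.
have [j jH gj0] : exists2 j, j \in ~: H & (0 < g j)%N.
  apply/exists_inP; apply: contraT; rewrite negb_exists_in => /forall_inP h.
  by move: bt; rewrite /b big1 // => i /h; rewrite lt0n negbK => /eqP.
have jH' : j \notin H by rewrite inE in jH.
exists (j |: A).
  by rewrite inE (stressed_extend sH) ?YH // cA rE.
split=> [i||].
- by rewrite !inE => /orP[/eqP -> //|]; apply: Y0.
- move=> i gi; rewrite !inE; have [//|ij /=] := eqVneq i j.
  apply: (fintype.subsetP XA); rewrite inE gi eqxx andbT.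
  (* A saturated [i] off [H] would exhaust [b = t + 1], leaving nothing for [g j > 0]. *)
  apply: contraT => iH; move: bt gj0.
  rewrite /b (bigD1 j) //= (bigD1 i) ?inE ?iH //= gi.
  by move: (g j) (\sum_(_ | _) _)%N; clear; lia.
- rewrite -ltnS -bt /b (bigD1 j) // [ltnRHS](bigD1 j) //= !inE eqxx /= -addSn.
  by rewrite leq_add ?subn1 ?prednK // leq_sum // => i _; exact: leq_subr.
Qed.

Lemma relaxed_cone_lattice t (g : 'I_n -> nat) :
  (forall i, g i <= t)%N -> (\sum_i g i = rank M * t)%N ->
  (\sum_(i in ~: H) g i <= t)%N ->
  base_cone (relaxed_bases M H) (\row_i (g i)%:R : 'rV[R]_n).
Proof.
elim: t g => [|t IHt] g gt gs gH.
  have -> : (\row_i (g i)%:R : 'rV[R]_n) = 0.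
    by apply/rowP => i; rewrite !mxE; have := gt i; rewrite leqn0 => /eqP ->.
  exact: base_cone0.
have [A bA [Ag gA AH]] := relaxed_base_peel gt gs gH.
have gD i : (g i = (g i - (i \in A)) + (i \in A))%N.
  by rewrite subnK //; case: (boolP (i \in A)) => [/Ag|].
have -> : (\row_i (g i)%:R : 'rV[R]_n)
    = \row_i (g i - (i \in A))%:R + indicator_vec R A.
  by apply/rowP => i; rewrite !mxE {1}gD natrD.
apply: base_coneD; last exact: base_cone_gen.
apply: IHt => // [i|].
  have := gt i; rewrite leq_eqVlt => /orP[/eqP gi|].
    by rewrite gi gA // subn1.
  by rewrite ltnS; apply: leq_trans (leq_subr _ _).
have cA : #|A| = rank M.
  by move: bA; rewrite !inE => /orP[/base_card|/andP[_ /eqP]].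
apply/eqP; rewrite -(eqn_add2r (rank M)) -[X in (_ + X)%N == _]cA -sum1_card.
rewrite [X in (_ + X)%N]big_mkcond -big_split /= -mulnSr -gs.
by apply/eqP; apply: eq_bigr => i _; rewrite [RHS]gD; case: (i \in A).
Qed.

End Peeling.

(** * Base polytopes and Ehrhart functions *)

Local Open Scope classical_set_scope.
Local Open Scope convex_scope.

Section BasePolytope.
Variables (R : realType) (n : nat) (M : matroid 'I_n).

(** Convexity of a set is binary, so a weighted sum is accumulated one term at a time, normalised by
    the running total of the weights. *)
Lemma conv_hull_indicator (F : {set {set 'I_n}}) (x : 'rV[R]_n) :
  conv_hull [set indicator_vec R B | B in [set B | B \in F]] x <->
  exists w : {set 'I_n} -> R, [/\ forall B, 0 <= w B, \sum_(B in F) w B = 1 &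
    x = \sum_(B in F) w B *: indicator_vec R B].
Proof.
split=> [hx|[w [w0 w1 ->]] S [convS subS]].
  apply: (hx [set x | exists w : {set 'I_n} -> R,
    [/\ forall B, 0 <= w B, \sum_(B in F) w B = 1 &
        x = \sum_(B in F) w B *: indicator_vec R B]]); split.
    apply/convex_setW => a b; rewrite !inE /= => -[w [w0 w1 aE]] [v [v0 v1 bE]] k k0 k1.
    have -> : a <| k |> b
        = k%:num *: (a : 'rV[R]_n) + (1 - k%:num) *: (b : 'rV[R]_n) by [].
    rewrite inE /=; exists (fun B => k%:num * w B + (1 - k%:num) * v B); split=> [B||].
    - by rewrite addr_ge0 // mulr_ge0 // ?subr_ge0 ltW.
    - by rewrite big_split /= -!mulr_sumr w1 v1 !mulr1 addrC subrK.
    rewrite aE bE !scaler_sumr -big_split; apply: eq_bigr => B _.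
    by rewrite [RHS]scalerDl !scalerA.
  move=> _ [B /= BF <-]; exists (fun A => (A == B)%:R); split=> [A||].
  - exact: ler0n.
  - by rewrite (bigD1 B) //= eqxx big1 ?addr0 // => A /andP[_ /negbTE ->].
  rewrite (bigD1 B) //= eqxx scale1r big1 ?addr0 // => A /andP[_ /negbTE ->].
  by rewrite scale0r.
have comb (a b : 'rV[R]_n) (k : R) :
    0 <= k <= 1 -> S a -> S b -> S (k *: a + (1 - k) *: b).
  move=> /andP[k0 k1] Sa Sb; have := convS a b (Itv01 k0 k1).
  by rewrite !inE; apply.
(* Starting from a positive weight keeps every running total invertible. *)
have [B0 B0F wB0] : exists2 B, B \in F & 0 < w B.
  apply/exists_inP; apply: contraT; rewrite negb_exists_in => /forall_inP h.
  move/eqP: w1; rewrite big1 1?eq_sym ?oner_eq0 // => B /h.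
  by rewrite -leNgt => wB; apply/eqP; rewrite eq_le wB w0.
suff acc (s : seq {set 'I_n}) (c : R) (y : 'rV[R]_n) :
    0 < c -> S (c^-1 *: y) -> {subset s <= F} ->
    S ((c + \sum_(B <- s) w B)^-1 *: (y + \sum_(B <- s) w B *: indicator_vec R B)).
  have := acc [seq B <- enum F | B != B0] (w B0) (w B0 *: indicator_vec R B0) wB0.
  rewrite !big_filter !big_enum_cond -!(bigD1 B0) //= w1 invr1 scale1r; apply.
    by rewrite scalerA mulVf ?scale1r ?gt_eqF //; apply: subS; exists B0.
  by move=> B; rewrite mem_filter mem_enum => /andP[].
elim: s c y => [|B s IHs] c y c0 cy sF.
  by rewrite !big_nil !addr0.
rewrite !big_cons !addrA; have cw : 0 < c + w B by rewrite ltr_wpDr.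
apply: IHs => // [|A As]; last by rewrite sF // inE As orbT.
have -> : (c + w B)^-1 *: (y + w B *: indicator_vec R B)
    = (c / (c + w B)) *: (c^-1 *: y) + (1 - c / (c + w B)) *: indicator_vec R B.
  rewrite scalerDr !scalerA -mulrA [_^-1 * c^-1]mulrC mulrA divff ?gt_eqF // mul1r.
  by congr (_ + _ *: _); field; rewrite gt_eqF.
apply: comb => //.
  by rewrite divr_ge0 ?(ltW c0) ?(ltW cw) //= ler_pdivrMr // mul1r lerDl.
by apply: subS; exists B; rewrite //= sF // inE eqxx.
Qed.

(** All bases have the same positive size, so the coordinate sum of a cone point determines the
    total of its weights. *)
Lemma dilated_base_polytopeE t : (0 < rank M)%N ->
  dilated_lattice_points (@base_polytope R n M) t =
  [set x | base_cone (bases M) x /\ \sum_i x 0 i = (rank M * t)%:R]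
    `&` [set x | forall i, x 0 i \is a Num.int].
Proof.
move=> r0; congr (_ `&` _); apply/seteqP.
split=> [_ [x /conv_hull_indicator [w [w0 w1 ->]] <-]|x /= [[w w0 ->]]].
  split; first by apply: base_coneZ; [exact: ler0n|exists w].
  under eq_bigr => i _ do rewrite mxE.
  rewrite -mulr_sumr sum_comb_indicatorT (eq_bigr (fun B => w B * (rank M)%:R)) => [|B].
    by rewrite -mulr_suml w1 mul1r mulrC natrM.
  by move/base_card ->.
rewrite sum_comb_indicatorT (eq_bigr (fun B => w B * (rank M)%:R)) => [|B].
  rewrite -mulr_suml natrM mulrC => /mulfI wt.
  have {}wt : \sum_(B in bases M) w B = t%:R by apply: wt; rewrite pnatr_eq0 -lt0n.
  (* For [t = 0] the weights cannot be divided by [t]; they all vanish, and any base gives a point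
     of the polytope to scale to 0. *)
  have [t0|t0] := posnP t.
    have /finset.set0Pn [B bB] := bases_neq0 M.
    exists (indicator_vec R B).
      by move=> S [_]; apply; exists B.
    rewrite t0 scale0r big1 // => A bA.
    have -> : w A = 0 by apply: (psumr_eq0P _ _ bA) => [A' _|]; rewrite ?w0 ?wt ?t0.
    by rewrite scale0r.
  have tn0 : t%:R != 0 :> R by rewrite pnatr_eq0 -lt0n.
  exists (t%:R^-1 *: \sum_(B in bases M) w B *: indicator_vec R B).
    apply/conv_hull_indicator; exists (fun B => t%:R^-1 * w B); split=> [B||].
    - by rewrite mulr_ge0 // invr_ge0.
    - by rewrite -mulr_sumr wt mulVf.
    by rewrite scaler_sumr; apply: eq_bigr => B _; rewrite scalerA.
  by rewrite scalerA divff // scale1r.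
by move/base_card ->.
Qed.

End BasePolytope.

Lemma card_fset_set_image_pred (T : finType) (U : choiceType) (h : T -> U) (P : pred T) :
  injective h -> #|` fset_set [set h x | x in [set` P]]| = #|P|.
Proof.
move=> injh; rewrite fset_set_image; last exact: finite_finset.
rewrite card_imfset //= -card_finset; congr (#|` _|).
by rewrite -[RHS]set_fsetK; congr fset_set; apply/seteqP; split=> x /=; rewrite !inE.
Qed.

(** * Lattice points gained by relaxing *)

Section Relaxation.
Variables (R : realType) (n : nat) (M : matroid 'I_n) (H : {set 'I_n}).
Hypothesis sH : stressed_hyperplane M H.
Let f t (g : {ffun 'I_n -> 'I_t.+1}) : 'rV[R]_n := \row_i (g i)%:R.

Lemma rank_relaxation : rank (relaxation sH) = rank M.
Proof.
have /finset.set0Pn [B bB] := bases_neq0 M.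
by rewrite -(base_card bB) (@base_card _ (relaxation sH) B) // inE bB.
Qed.

Lemma cap_points_sum_gt t (g : {ffun 'I_n -> 'I_t.+1}) :
  (\sum_i g i = rank M * t)%N ->
  ((\sum_(i in ~: H) g i < t)%N = ((rank M).-1 * t < \sum_(i in H) g i)%N).
Proof.
have := sum_nat_setC H (fun i => g i : nat).
rewrite (rank_hyperplane sH) mulSn /=.
by move: (\sum_i _)%N (\sum_(i in H) _)%N (\sum_(i in ~: H) _)%N (_ * t)%N; clear; lia.
Qed.

(** Homogeneous form of [0 <= x_i <= 1]: on the [t]-th dilate it bounds every coordinate by [t]. *)
Lemma base_cone_coord (M' : matroid 'I_n) (x : 'rV[R]_n) i :
  base_cone (bases M') x -> 0 <= x 0 i /\ (rank M')%:R * x 0 i <= \sum_j x 0 j.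
Proof.
case=> w w0 ->; rewrite sum_comb_indicatorT summxE mulr_sumr; split.
  by apply: sumr_ge0 => B _; rewrite !mxE mulr_ge0 // ler0n.
apply: ler_sum => B /base_card ->; rewrite !mxE mulrC ler_wpM2r ?ler0n //.
by rewrite ler_piMr // lern1 leq_b1.
Qed.

(** The facet inequality decides: a point satisfying it lies in the cone of [M], and one violating
    it has integer coordinates in [0..t], hence is a cap point. *)
Lemma dilated_relaxationE t :
  dilated_lattice_points (@base_polytope R n (relaxation sH)) t =
  dilated_lattice_points (@base_polytope R n M) t
  `|` [set f g | g in [set` cap_points t H (rank M)]].
Proof.
have r0 : (0 < rank M)%N by rewrite (rank_hyperplane sH).
have rn0 : 0 < (rank M)%:R :> R by rewrite ltr0n.
rewrite !dilated_base_polytopeE ?rank_relaxation //.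
apply/seteqP; split=> x /=.
  move=> [[cx sx] ix].
  have [hle|hgt] := leP ((rank M)%:R * \sum_(i in H) x 0 i)
                        ((rank M).-1%:R * \sum_i x 0 i).
    by left; do 2!split=> //; apply: relaxed_cone_hyperplane hle.
  right.
  have /choice [g gE] : forall i, exists m : 'I_t.+1, x 0 i = m%:R.
    move=> i; have [x0] := @base_cone_coord (relaxation sH) x i cx.
    rewrite rank_relaxation sx natrM ler_pM2l // => xt.
    have /natrP [m xm] : x 0 i \is a Num.nat by rewrite natrEint ix x0.
    have mt : (m < t.+1)%N by rewrite ltnS -(ler_nat R) -xm.
    by exists (Ordinal mt).
  exists [ffun i => g i]; last by apply/rowP => i; rewrite mxE ffunE gE.
  have gs : (\sum_i [ffun i => g i] i = rank M * t)%N.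
    apply/eqP; rewrite -(eqr_nat R) -sx natr_sum; apply/eqP.
    by apply: eq_bigr => i _; rewrite ffunE gE.
  rewrite /= inE gs eqxx cap_points_sum_gt //= -(ltr_nat R) natrM -(ltr_pM2l rn0).
  rewrite mulrCA -natrM -sx natr_sum.
  by under [X in _ < _ * X]eq_bigr => i _ do rewrite ffunE -gE.
case=> [[[cx sx] ix]|[g + <-]].
  by do 2!split=> //; apply: base_coneS cx; apply: finset.subsetUl.
rewrite inE => /andP[/eqP gs gH]; split; first split.
- apply: relaxed_cone_lattice (ltnW gH) => // i.
  by rewrite -ltnS ltn_ord.
- by rewrite -gs natr_sum; apply: eq_bigr => i _; rewrite mxE.
- by move=> i; rewrite mxE natr_int.
Qed.

Lemma dilated_cap_disjoint t :
  dilated_lattice_points (@base_polytope R n M) t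
  `&` [set f g | g in [set` cap_points t H (rank M)]] = set0.
Proof.
have r0 : (0 < rank M)%N by rewrite (rank_hyperplane sH).
rewrite dilated_base_polytopeE //; apply/seteqP; split=> // x [[[cx _] _] [g + gE]].
move: cx; rewrite -gE /= => cx; rewrite inE => /andP[/eqP gs].
rewrite cap_points_sum_gt //.
have fE i : f g 0 i = (g i)%:R by rewrite mxE.
have := base_cone_hyperplane_le sH cx; rewrite !(eq_bigr _ (fun i _ => fE i)).
rewrite -!natr_sum -!natrM ler_nat gs mulnCA leq_pmul2l // => h.
by rewrite ltnNge h.
Qed.

Lemma ehr_relaxation t :
  ehr R (relaxation sH) t = (ehr R M t + #|cap_points t H (rank M)|)%N.
Proof.
have finf : finite_set [set f g | g in [set` cap_points t H (rank M)]].
  exact/finite_image/finite_finset.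
have finM := @base_polytope_lattice_finite R n M t.
rewrite /ehr dilated_relaxationE fset_setU // cardfsU -fset_setI //.
rewrite dilated_cap_disjoint fset_set0 cardfs0 subn0.
congr addn; apply: card_fset_set_image_pred => g1 g2 /rowP e12.
apply/ffunP => i; apply/val_inj/eqP; rewrite -(eqr_nat R).
by have := e12 i; rewrite !mxE => ->.
Qed.

End Relaxation.

Theorem theorem5p8 (R : realType) (n r s : nat) (M : matroid 'I_n)
    (rM : rank M = r) (H : {set 'I_n}) (sH : stressed_hyperplane M H)
    (cH : #|H| = s) (t : nat) :
  (ehr R (relaxation sH) t)%:R =
    (ehr R M t)%:R
    + (n - s)%:R / (n - 1)`!%:R
      * binz (t%:Z - 1 + n%:Z - s%:Z) (n - s) * phi_tilde r s n t :> rat.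
Proof.
rewrite ehr_relaxation natrD; congr (_ + _); rewrite rM.
have r0 : (0 < r)%N by rewrite -rM (rank_hyperplane sH).
(* For [s < r] the outer sum is empty, and so is the cap: [g(H) <= s t] and [g(~: H) < t] give a sum
   below [(s + 1) t <= r t]. *)
have [sr|rs] := ltnP s r.
  rewrite /phi_tilde big_geq ?mulr0; last by rewrite leqn0 subn_eq0.
  rewrite (@eq_card0 _ (cap_points t H r)) // => g.
  apply/negbTE; rewrite inE; apply/negP => /andP[/eqP gs].
  have gH : (\sum_(i in H) g i <= s * t)%N.
    by rewrite -cH -sum_nat_const; apply: leq_sum => i _; rewrite -ltnS.
  have := sum_nat_setC H (fun i => g i : nat).
  rewrite gs => e gt; have : (s.+1 * t <= r * t)%N by rewrite leq_mul2r sr orbT.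
  rewrite e mulSn; move: gH gt; clear.
  by move: (\sum_(i in H) _)%N (\sum_(i in ~: H) _)%N (_ * _)%N; clear; lia.
(* [H] is a proper subset, since its rank is one less than that of [M]. *)
have sn : (s < n)%N.
  rewrite -cH -[X in (_ < X)%N]card_ord -cardsT; apply: proper_card.
  rewrite properT; apply/eqP => HT; have := rank_hyperplane sH.
  by rewrite HT /rank => /n_Sn.
have [m em] : exists m, (n - s = m.+1)%N by exists (n - s).-1; lia.
have [p ep] : exists p, s = p.+1 by exists s.-1; lia.
rewrite {}ep in cH rs sn em *.
have cHc : #|~: H| = m.+1 by rewrite cardsCs finset.setCK card_ord cH.
rewrite (card_cap_points t cHc) cH ?r0 // em.
have -> : t%:Z - 1 + n%:Z - p.+1%:Z = (t + m)%N%:Z by lia.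
rewrite binz_nat; have -> : (n - 1 = (m + p).+1)%N by lia.
rewrite /phi_tilde big_mkord mulr_sumr; apply: eq_bigr => i _.
rewrite [RHS]mulrCA; congr (_ * _).
rewrite sum_bin_binz subn1 /= big_mkord; congr (_ * _).
apply: eq_bigr => l _.
have := ltn_ord l => lp.
have -> : (n - 2 - l = m + p - l)%N by lia.
by congr (_ * binz _ _ * binz _ _); lia.
Qed.
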